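(* Let $V$ be a real inner product space of finite dimension $n\ge 1$ with a fixed ordered orthonormal basis $(e_1,\ldots,e_n)$, and let $\det: V^n\to\mathbb{R}$ be the geometric determinant, i.e. $\det(v_1,\ldots,v_n)=S(v_1,\ldots,v_n)\,\mathrm{vol}(v_1,\ldots,v_n)$ if $(v_1,\ldots,v_n)$ is a basis of $V$, and $\det(v_1,\ldots,v_n)=0$ otherwise, where $S$ is the geometric orientation with respect to $(e_1,\ldots,e_n)$ and $\mathrm{vol}$ is the volume of the parallelepiped, both as defined in the context. Then for all vectors $v_1,\ldots,v_n\in V$, every scalar $t\in\mathbb{R}$ and all indices $i\neq j$ in $\{1,\ldots,n\}$: (D1) $\det(v_1,\ldots,tv_i,\ldots,v_n)=t\det(v_1,\ldots,v_i,\ldots,v_n)$ (for every index $i$, also when $n=1$); (D2) $\det(v_1,\ldots,v_i+v_j,\ldots,v_j,\ldots,v_n)=\det(v_1,\ldots,v_i,\ldots,v_j,\ldots,v_n)$, where on the left the $i$-th vector $v_i$ is replaced by $v_i+v_j$ and all other vectors are unchanged.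
   Context: $V$ is a real inner product space of dimension $n$, with inner product $u\cdot v$, norm $|\cdot|$, and a fixed ordered orthonormal basis $(e_1,\ldots,e_n)$. Rotations. For noncollinear unit vectors $u,w$, put $\widehat{u}=\dfrac{u-(w\cdot u)w}{|u-(w\cdot u)w|}$ and, for $t\in\mathbb{R}$, $v\in V$, $$R_{u,w}^t v = v-(\widehat u\cdot v)\widehat u-(w\cdot v)w+(\cos(t)(\widehat u\cdot v)-\sin(t)(w\cdot v))\widehat u+(\sin(t)(\widehat u\cdot v)+\cos(t)(w\cdot v))w,$$ and $T_{u,w}=\dfrac{\widehat u\cdot u}{|\widehat u\cdot u|}\arccos(w\cdot u)$. One has $R_{u,w}^0v=v$ and $R_{u,w}^{T_{u,w}}u=w$. Orientation of orthonormal bases. The orientation $S_n(u_1,\ldots,u_n)\in\{1,-1\}$ of an ordered orthonormal basis $(u_1,\ldots,u_n)$ with respect to $(e_1,\ldots,e_n)$ is defined inductively on $n$: (n=1) $S_1(u_1)=1$ if $u_1=e_1$ and $S_1(u_1)=-1$ if $u_1=-e_1$. (n=2) For $k=1,2$ let $c_k(t)=(\cos(t)(e_1\cdot u_k)-\sin(t)(e_2\cdot u_k))e_1+(\sin(t)(e_1\cdot u_k)+\cos(t)(e_2\cdot u_k))e_2$, and $T_2=\dfrac{e_1\cdot u_2}{|e_1\cdot u_2|}\arccos(e_2\cdot u_2)$ (if $e_1\cdot u_2=0$, the sign factor may be taken to be $1$ or $-1$; this does not affect the outcome). Then $c_2(T_2)=e_2$ and $c_1(T_2)=\pm e_1$;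 set $S_2(u_1,u_2)=1$ if $c_1(T_2)=e_1$ and $-1$ if $c_1(T_2)=-e_1$. (n≥3) If $u_n\ne\pm e_n$, set $S_n(u_1,\ldots,u_n)=S_{n-1}(R_{u_n,e_n}^{T_n}u_1,\ldots,R_{u_n,e_n}^{T_n}u_{n-1})$ with $T_n=T_{u_n,e_n}$, where the orthonormal vectors on the right form an ordered orthonormal basis of the span of $(e_1,\ldots,e_{n-1})$ and $S_{n-1}$ is the orientation with respect to $(e_1,\ldots,e_{n-1})$. If $u_n=\pm e_n$, $S_n(u_1,\ldots,u_n)$ is defined as the common value of $S_n(u_1',\ldots,u_n')$ for all ordered orthonormal bases $(u_1',\ldots,u_n')$ sufficiently close to $(u_1,\ldots,u_n)$ with $u_n'\ne\pm e_n$ (this is well defined). Orientation of general bases. For an ordered basis $(v_1,\ldots,v_n)$ of $V$, $S(v_1,\ldots,v_n)=S_n(G(v_1,\ldots,v_n))$, where $G(v_1,\ldots,v_n)=(u_1,\ldots,u_n)$ is the Gram–Schmidt orthonormalization: $u_1=v_1/|v_1|$, $u_i=\dfrac{v_i-\sum_{j<i}(v_i\cdot u_j)u_j}{|v_i-\sum_{j<i}(v_i\cdot u_j)u_j|}$. Volume. $P(v_1,\ldots,v_n)=\{t_1v_1+\cdots+t_nv_n: t_1,\ldots,t_n\in[0,1)\}$ and $\mathrm{vol}(v_1,\ldots,v_n)=\mu(P(v_1,\ldots,v_n))$, where $\mu$ is the unique translation-invariant (Borel) measure on $V$ with $\mu(P(e_1,\ldots,e_n))=1$. *)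

(* Defs.v *)
From HB Require Import structures.
From mathcomp Require Import all_boot all_order all_algebra.
From mathcomp Require Import all_classical all_reals all_analysis.
Set Implicit Arguments.
Unset Strict Implicit.
Unset Printing Implicit Defensive.
Import Order.TTheory GRing.Theory Num.Theory.
Import numFieldNormedType.Exports.
Local Open Scope classical_set_scope.
Local Open Scope ring_scope.

Section EuclideanGeometry.
Context {R : realType} {V : vectType R}.

(* A real inner product is a positive definite symmetric bilinear form, i.e. a
   dot product for the trivial conjugation. *)
Variable dot : {dot V for @idfun R}.

Definition vnorm (x : V) : R := Num.sqrt (dot x x).

Definition normalize (x : V) : V := (vnorm x)^-1 *: x.

Definition onb_of (W : {vspace V}) (k : nat) (u : 'I_k -> V) : bool :=
  orthonormal dot (codom u) && basis_of W (codom u).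

Definition hatv (u w : V) : V := normalize (u - dot w u *: w).

Definition rot (u w : V) (t : R) (v : V) : V :=
  let a := hatv u w in
  v - dot a v *: a - dot w v *: w
  + (cos t * dot a v - sin t * dot w v) *: a
  + (sin t * dot a v + cos t * dot w v) *: w.

Definition rot_angle (u w : V) : R :=
  let c := dot (hatv u w) u in c / `|c| * acos (dot w u).

(* The sign factor of T_2 is fixed to be 1 when e_1 . u_2 = 0. *)
Definition orient2 (e1 e2 u1 u2 : V) : int :=
  let x := dot e1 u2 in
  let T := (if x == 0 then 1 else x / `|x|) * acos (dot e2 u2) in
  let c1 := (cos T * dot e1 u1 - sin T * dot e2 u1) *: e1
            + (sin T * dot e1 u1 + cos T * dot e2 u1) *: e2 in
  if c1 == e1 then 1 else -1.

Definition initv (k : nat) (u : 'I_k.+1 -> V) : 'I_k -> V :=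
  fun i => u (widen_ord (leqnSn k) i).

(* S_{k+1} in terms of S_k, when the last vector of u is not plus or minus the
   last vector of e. *)
Definition orient_generic (k : nat) (S : ('I_k -> V) -> ('I_k -> V) -> int)
    (e u : 'I_k.+1 -> V) : int :=
  let un := u ord_max in
  let en := e ord_max in
  S (initv e) (fun i => rot un en (rot_angle un en) (initv u i)).

Definition in_general_position (k : nat) (e u : 'I_k.+1 -> V) : bool :=
  (u ord_max != e ord_max) && (u ord_max != - e ord_max).

(* In the degenerate case the value is the one shared by all nearby orthonormal
   bases of the same subspace that are in general position; since such bases
   exist arbitrarily close, at most one s qualifies and the default 0 of [xget]
   is irrelevant. *)
Definition orient_step (k : nat) (S : ('I_k -> V) -> ('I_k -> V) -> int)
    (e u : 'I_k.+1 -> V) : int :=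
  if in_general_position e u then orient_generic S e u
  else xget 0 [set s : int | exists2 eps : R, 0 < eps &
         forall u' : 'I_k.+1 -> V,
           onb_of <<codom e>>%VS u' ->
           in_general_position e u' ->
           (forall i, vnorm (u' i - u i) < eps) ->
           orient_generic S e u' = s].

(* S_{k+1}, where S is S_k; S is used only when k + 1 >= 3.  On orthonormal
   bases, the vector tested for k + 1 = 1, 2 is plus or minus the first vector
   of e, so that the alternative -1 is reached exactly in the minus case. *)
Definition orient_succ (k : nat) :
    (('I_k -> V) -> ('I_k -> V) -> int) ->
    ('I_k.+1 -> V) -> ('I_k.+1 -> V) -> int :=
  match k with
  | 0%N => fun _ e u => if u ord0 == e ord0 then 1 else -1
  | 1%N => fun _ e u => orient2 (e ord0) (e ord_max) (u ord0) (u ord_max)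
  | _ => fun S => orient_step S
  end.

(* [orient e u] is S_k(u_1, ..., u_k) with respect to (e_1, ..., e_k); it is
   meaningful when 0 < k and e, u are orthonormal bases of the same subspace,
   which is all of V at top level and the span of the first vectors of the
   fixed basis in recursive calls. *)
Fixpoint orient (k : nat) : ('I_k -> V) -> ('I_k -> V) -> int :=
  match k with
  | 0%N => fun _ _ => 1
  | m.+1 => orient_succ (@orient m)
  end.

Definition gram_schmidt_seq (s : seq V) : seq V :=
  foldl (fun us x => rcons us (normalize (x - \sum_(u <- us) dot x u *: u)))
    [::] s.

Definition gram_schmidt (n : nat) (v : 'I_n -> V) : 'I_n -> V :=
  fun i => nth 0 (gram_schmidt_seq (codom v)) i.

Definition orientation (n : nat) (e v : 'I_n -> V) : int :=
  orient e (gram_schmidt v).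

Definition parallelepiped (n : nat) (v : 'I_n -> V) : set V :=
  [set x | exists2 t : 'I_n -> R,
     (forall i, 0 <= t i < 1) & x = \sum_i t i *: v i].

Definition norm_open : set (set V) :=
  [set A | forall x, A x ->
     exists2 eps : R, 0 < eps & forall y, vnorm (y - x) < eps -> A y].

(* A copy of V, pointed at 0 as [g_sigma_algebraType] requires. *)
Definition pointed_copy : Type := V.
HB.instance Definition _ := Choice.on pointed_copy.
HB.instance Definition _ := isPointed.Build pointed_copy (0 : V).

Definition borel : measurableType _ :=
  g_sigma_algebraType (norm_open : set (set pointed_copy)).

Definition normalized_invariant_measure (n : nat) (e : 'I_n -> V)
    (mu : {measure set borel -> \bar R}) : Prop :=
  (forall (a : V) (A : set borel), measurable A ->
     mu [set (a + x : V) | x in A] = mu A) /\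
  mu (parallelepiped e) = 1%E.

(* [fine] loses nothing: parallelepipeds are bounded, so have finite measure. *)
Definition vol (mu : {measure set borel -> \bar R}) (n : nat)
    (v : 'I_n -> V) : R :=
  fine (mu (parallelepiped v)).

Definition geom_det (mu : {measure set borel -> \bar R}) (n : nat)
    (e v : 'I_n -> V) : R :=
  if basis_of fullv (codom v) then (orientation e v)%:~R * vol mu v else 0.

End EuclideanGeometry.

(* Main.v *)
(* For an orthonormal basis u, the orientation of u is the determinant of its
   matrix in the basis e: the rotations used in the inductive definition have
   determinant 1, and once a rotation has mapped the last vector of u to the
   last vector of e, the determinant is that of the remaining vectors; near a
   degenerate basis the determinant, being 1 or -1, is constant. The change of
   basis of Gram-Schmidt is triangular with positive diagonal, so the
   orientation of a basis v is the sign of det v, and det v also vanishes when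
   v is not a basis. Hence the geometric determinant is always
   sg (det v) * vol v, and it remains to see how vol behaves. A shear is undone
   by cutting the half-open parallelepiped and translating one piece. For the
   scaling of one edge by t, the measure is additive in t > 0, hence linear;
   a negative t gives a translate of the parallelepiped open at the other end,
   which has the same measure because opposite faces are translates of each
   other. *)

Require Import Defs.
From HB Require Import structures.
From mathcomp Require Import all_boot all_order all_algebra.
From mathcomp Require Import all_classical all_reals all_analysis.
From mathcomp Require Import ring lra.
Set Implicit Arguments.
Unset Strict Implicit.
Unset Printing Implicit Defensive.
Import Order.TTheory GRing.Theory Num.Theory.
Local Open Scope ring_scope.

(** * Determinants *)

Lemma det_orthogonal_sqr (R : realFieldType) k (A : 'M[R]_k) : A *m A^T = 1%:M -> \det A ^+ 2 = 1.
Proof. by move=> h; rewrite expr2 -{2}det_tr -det_mulmx h det1. Qed.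

(* An orthogonal A of determinant -1 has A + 1 singular, because
   A + 1 = A (1 + A)^T; this is impossible when A is close to 1. *)
Lemma det_orthogonal_near1 (R : realFieldType) k (A : 'M[R]_k) : A *m A^T = 1%:M ->
  (forall i j, `|A i j - (i == j)%:R| < k%:R^-1) -> \det A = 1.
Proof.
move=> oA nA; apply/eqP; have /eqP := det_orthogonal_sqr oA.
rewrite sqrf_eq1 => /orP[//|/eqP dA].
have : \det (A + 1%:M) == 0.
  have /(congr1 determinant) : A + 1%:M = A *m (A + 1%:M)^T.
    by rewrite linearD /= mulmxDr oA trmx1 mulmx1 addrC.
  rewrite det_mulmx dA det_tr mulN1r => /eqP.
  by rewrite -addr_eq0 -mulr2n mulrn_eq0.
case/det0P => y y0 yA.
case: k A oA nA dA y y0 yA => [|k] A oA nA dA y y0 yA.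
  by case/eqP: y0; apply/matrixP => ? [].
(* Column [m] of [y (A + 1) = 0] reads: the sum over [j] of [y_j (A j m - (j == m))] equals
   [-2 y_m]. With [|y_m|] maximal and each of the [k + 1] entries at most [1 / (k + 1)], the sum is
   at most [|y_m|] in absolute value, so [y_m = 0]. *)
pose m := [arg max_(i > ord0) `|y 0 i|]%O.
have my i : `|y 0 i| <= `|y 0 m| by rewrite /m; case: arg_maxP => // j _; apply.
have : y 0 m = 0.
  have /matrixP/(_ 0 m) := yA; rewrite !mxE => hm.
  have {}hm : \sum_j y 0 j * (A j m - (j == m)%:R) = - (2 * y 0 m).
    apply/eqP; rewrite -subr_eq0 opprK; apply/eqP; rewrite -[RHS]hm.
    have -> : 2 * y 0 m = \sum_j 2 * (y 0 j * (j == m)%:R).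
      rewrite -mulr_sumr (bigD1 m) //= eqxx mulr1 big1 ?addr0 // => j jm.
      by rewrite (negbTE jm) mulr0.
    by rewrite -big_split; apply: eq_bigr => j _; rewrite !mxE /=; ring.
  have : `|2 * y 0 m| <= `|y 0 m|.
    rewrite -normrN -hm; apply: le_trans (ler_norm_sum _ _ _) _.
    have -> : `|y 0 m| = \sum_(j < k.+1) `|y 0 m| * k.+1%:R^-1.
      by rewrite -mulr_suml sumr_const card_ord -(mulr_natr `|y 0 m|) mulfK // pnatr_eq0.
    apply: ler_sum => j _; rewrite normrM ler_pM ?normr_ge0 //.
    exact/ltW/nA.
  rewrite normrM ger0_norm //; have := normr_ge0 (y 0 m) => h1 h2.
  by apply/eqP; rewrite -normr_le0; lra.
move=> y0m; case/eqP: y0; apply/matrixP => i j; rewrite ord1 mxE.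
by apply/eqP; rewrite -normr_le0 (le_trans (my j)) // y0m normr0.
Qed.

(** * Inner products and orthonormal families *)

Section Orientation.
Context {R : realType} {V : vectType R}.
Variable dot : {dot V for @idfun R}.
Implicit Types (x y : V).

Lemma dotC x y : dot x y = dot y x.
Proof. by rewrite hermC expr0 mul1r. Qed.

Lemma dotDl x y z : dot (x + y) z = dot x z + dot y z.
Proof. exact: linearDl. Qed.

Lemma dotDr x y z : dot z (x + y) = dot z x + dot z y.
Proof. exact: linearDr. Qed.

Lemma dotBl x y z : dot (x - y) z = dot x z - dot y z.
Proof. exact: linearBl. Qed.

Lemma dotBr x y z : dot z (x - y) = dot z x - dot z y.
Proof. exact: linearBr. Qed.

Lemma dotZl a x z : dot (a *: x) z = a * dot x z.
Proof. exact: linearZl_LR. Qed.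

Lemma dotZr a x z : dot z (a *: x) = a * dot z x.
Proof. by rewrite dotC dotZl dotC. Qed.

Lemma dot0l x : dot 0 x = 0.
Proof. exact: linear0l. Qed.

Lemma dot0r x : dot x 0 = 0.
Proof. by rewrite dotC dot0l. Qed.

Lemma dotNl x z : dot (- x) z = - dot x z.
Proof. exact: linearNl. Qed.

Lemma dotNr x z : dot z (- x) = - dot z x.
Proof. exact: linearNr. Qed.

Definition dotE := (dotDl, dotDr, dotNl, dotNr, dotZl, dotZr).

Lemma dot_suml I r (P : pred I) (F : I -> V) z :
  dot (\sum_(i <- r | P i) F i) z = \sum_(i <- r | P i) dot (F i) z.
Proof. exact: linear_sumlz. Qed.

Lemma dot_sumr I r (P : pred I) (F : I -> V) z :
  dot z (\sum_(i <- r | P i) F i) = \sum_(i <- r | P i) dot z (F i).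
Proof. exact: linear_sumr. Qed.

Lemma dot_gt0 x : (0 < dot x x) = (x != 0).
Proof.
have [->|x0] := eqVneq x 0; first by rewrite linear0l ltxx.
exact: neq0_dnorm_gt0.
Qed.

Lemma dot_ge0 x : 0 <= dot x x.
Proof.
have [->|x0] := eqVneq x 0; first by rewrite linear0l.
by rewrite ltW // dot_gt0.
Qed.

Lemma sqr_vnorm x : vnorm dot x ^+ 2 = dot x x.
Proof. by rewrite sqr_sqrtr // dot_ge0. Qed.

Lemma vnorm_ge0 x : 0 <= vnorm dot x.
Proof. exact: sqrtr_ge0. Qed.

Lemma vnorm_gt0 x : (0 < vnorm dot x) = (x != 0).
Proof. by rewrite sqrtr_gt0 dot_gt0. Qed.

Lemma cauchy_schwarz_dot x y : `|dot x y| <= vnorm dot x * vnorm dot y.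
Proof.
rewrite -ler_sqr ?nnegrE ?mulr_ge0 ?vnorm_ge0 // real_normK ?num_real //.
rewrite exprMn !sqr_vnorm.
have [->|y0] := eqVneq y 0; first by rewrite !dot0r expr0n mulr0.
have := dot_ge0 (dot y y *: x - dot x y *: y).
rewrite !dotE (dotC y x).
have := dot_gt0 y; rewrite y0.
by move: (dot x x) (dot y y) (dot x y) => a b c b0 h; nra.
Qed.

Definition is_ortho k (u : 'I_k -> V) := forall i j, dot (u i) (u j) = (i == j)%:R.

(** For orthonormal [e] this is membership in the span of [e], in the equational form that matrix
    computations use. *)
Definition expands k (e : 'I_k -> V) x := x = \sum_j dot x (e j) *: e j.

(** When [e] is orthonormal and [u] lies in its span, this is the matrix of [u] in the basis [e],
    one row per vector of [u]. *)
Definition gram_mx k (e u : 'I_k -> V) : 'M[R]_k := \matrix_(i, j) dot (u i) (e j).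

Lemma expandsD k (e : 'I_k -> V) x y : expands e x -> expands e y -> expands e (x + y).
Proof.
move=> hx hy; rewrite /expands {1}hx {1}hy -big_split; apply: eq_bigr => j _.
by rewrite dotDl scalerDl.
Qed.

Lemma expandsZ k (e : 'I_k -> V) a x : expands e x -> expands e (a *: x).
Proof.
move=> hx; rewrite /expands {1}hx scaler_sumr; apply: eq_bigr => j _.
by rewrite dotZl scalerA.
Qed.

Lemma expandsB k (e : 'I_k -> V) x y : expands e x -> expands e y -> expands e (x - y).
Proof. by move=> hx hy; apply: expandsD => //; rewrite -scaleN1r; apply: expandsZ. Qed.

Lemma expands_ortho k (e : 'I_k -> V) i : is_ortho e -> expands e (e i).
Proof.
move=> oe; rewrite /expands (bigD1 i) //= oe eqxx scale1r big1 ?addr0 // => j ji.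
by rewrite oe eq_sym (negbTE ji) scale0r.
Qed.

Lemma dot_expands k (e : 'I_k -> V) x y : expands e x ->
  dot x y = \sum_j dot x (e j) * dot (e j) y.
Proof.
by move=> {1}->; rewrite dot_suml; apply: eq_bigr => j _; rewrite dotZl.
Qed.

(** Serves as change of basis and, for [f = u], as orthogonality of the matrix of an orthonormal
    family. *)
Lemma gram_mx_chain k (e f u : 'I_k -> V) : (forall i, expands e (u i)) ->
  gram_mx f u = gram_mx e u *m gram_mx f e.
Proof.
move=> h; apply/matrixP => i j; rewrite !mxE (dot_expands _ (h i)).
by apply: eq_bigr => l _; rewrite !mxE.
Qed.

Lemma gram_mx_tr k (e u : 'I_k -> V) : (gram_mx e u)^T = gram_mx u e.
Proof. by apply/matrixP => i j; rewrite !mxE dotC. Qed.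

Lemma gram_mx_ortho k (e : 'I_k -> V) : is_ortho e -> gram_mx e e = 1%:M.
Proof. by move=> oe; apply/matrixP => i j; rewrite !mxE oe. Qed.

Lemma gram_mx_orthogonal k (e u : 'I_k -> V) : is_ortho u ->
  (forall i, expands e (u i)) -> gram_mx e u *m (gram_mx e u)^T = 1%:M.
Proof. by move=> ou h; rewrite gram_mx_tr -gram_mx_chain // gram_mx_ortho. Qed.

(** * Plane rotations *)

(* The rotation by the angle of cosine [c] and sine [s] in the plane of the
   orthonormal pair [(a, w)]. *)
Definition turn (a w : V) (c s : R) (v : V) : V :=
  v + ((c - 1) * dot a v - s * dot w v) *: a + (s * dot a v + (c - 1) * dot w v) *: w.

(** Only the cosine and sine of the angle enter, so a rotation can also be given by any point of the
    unit circle, without naming its angle. *)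
Lemma rot_turn u w t v : Defs.rot dot u w t v = turn (hatv dot u w) w (cos t) (sin t) v.
Proof.
rewrite /Defs.rot /turn; set a := hatv _ _ _.
have E (b : V) (x y z : R) : x = y + z -> x *: b = y *: b + z *: b by move=> ->; rewrite scalerDl.
rewrite (E a ((cos t - 1) * dot a v - sin t * dot w v) (- dot a v) (cos t * dot a v - sin t * dot w v)); last by ring.
rewrite (E w (sin t * dot a v + (cos t - 1) * dot w v) (- dot w v) (sin t * dot a v + cos t * dot w v)); last by ring.
by rewrite !scaleNr !addrA; congr (_ + _); apply: addrAC.
Qed.

Section Turn.
Variables (a w : V).
Hypotheses (aa : dot a a = 1) (ww : dot w w = 1) (wa : dot w a = 0).

Lemma dot_turn_l c s v : dot a (turn a w c s v) = c * dot a v - s * dot w v.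
Proof. by rewrite /turn !dotE (dotC a w) aa wa; ring. Qed.

Lemma dot_turn_r c s v : dot w (turn a w c s v) = s * dot a v + c * dot w v.
Proof. by rewrite /turn !dotE ww wa; ring. Qed.

Lemma dot_turn c s x y : c ^+ 2 + s ^+ 2 = 1 ->
  dot (turn a w c s x) (turn a w c s y) = dot x y.
Proof.
move=> cs; rewrite [X in dot _ X]/turn !dotDr !dotZr.
rewrite (dotC _ a) (dotC _ w) dot_turn_l dot_turn_r /turn !dotDl !dotZl.
set p := dot a x; set q := dot w x; set p' := dot a y; set q' := dot w y.
transitivity (dot x y + (c ^+ 2 + s ^+ 2 - 1) * (p * p' + q * q')); first by ring.
by rewrite cs subrr mul0r addr0.
Qed.

Lemma dot_turn_adj c s x y : dot (turn a w c s x) y = dot x (turn a w c (- s) y).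
Proof. by rewrite /turn !dotE (dotC x a) (dotC x w); ring. Qed.

Lemma turn_turn c s c' s' v : turn a w c s (turn a w c' s' v) =
  turn a w (c * c' - s * s') (s * c' + c * s') v.
Proof.
rewrite {1}/turn dot_turn_l dot_turn_r {1}/turn.
rewrite -!addrA (addrCA (_ *: w) (_ *: a)) !addrA.
rewrite -(addrA v) -scalerDl -addrA -scalerDl /turn.
by congr (_ + _ *: _ + _ *: _); ring.
Qed.

(** The vector moves by a chord: [2 - 2c] is the squared chord of the unit circle, scaled by the
    squared length of the projection of [v] to the plane. *)
Lemma sqr_dist_turn c s v : c ^+ 2 + s ^+ 2 = 1 ->
  vnorm dot (turn a w c s v - v) ^+ 2 = (2 - 2 * c) * (dot a v ^+ 2 + dot w v ^+ 2).
Proof.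
move=> cs; rewrite /turn -[v + _ + _]addrA [v + _]addrC addrK sqr_vnorm !dotE (dotC a w) aa wa ww.
set p := dot a v; set q := dot w v.
transitivity ((c ^+ 2 + s ^+ 2 + 1 - 2 * c) * (p ^+ 2 + q ^+ 2)); first by ring.
by rewrite cs; ring.
Qed.

Lemma expands_turn k (e : 'I_k -> V) c s v :
  expands e a -> expands e w -> expands e v -> expands e (turn a w c s v).
Proof. by move=> ea ew ev; do !apply: expandsD => //; apply: expandsZ. Qed.

(** Adjointness moves the rotation from [u] onto [e], where it splits off as a right factor
    independent of [u]. *)
Lemma gram_mx_turn k (e u : 'I_k -> V) c s : (forall i, expands e (u i)) ->
  gram_mx e (fun i => turn a w c s (u i)) =
  gram_mx e u *m gram_mx e (fun i => turn a w c s (e i)).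
Proof.
move=> eu; apply/matrixP => i j; rewrite !mxE dot_turn_adj (dot_expands _ (eu i)).
by apply: eq_bigr => l _; rewrite !mxE dot_turn_adj.
Qed.

(* The rotation by [t] is the square of the rotation by [t / 2], whose
   determinant is 1 or -1. *)
Lemma det_gram_mx_turn k (e u : 'I_k -> V) t : is_ortho e ->
  expands e a -> expands e w -> (forall i, expands e (u i)) ->
  \det (gram_mx e (fun i => turn a w (cos t) (sin t) (u i))) = \det (gram_mx e u).
Proof.
move=> oe ea ew eu; rewrite gram_mx_turn // det_mulmx.
pose g i := turn a w (cos (t / 2)) (sin (t / 2)) (e i).
have cs : cos (t / 2) ^+ 2 + sin (t / 2) ^+ 2 = 1 by exact: cos2Dsin2.
have eg i : expands e (g i) by apply: expands_turn => //; apply: expands_ortho.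
have -> : gram_mx e (fun i => turn a w (cos t) (sin t) (e i)) = gram_mx e g *m gram_mx e g.
  rewrite -gram_mx_turn //; apply/matrixP => i j; rewrite !mxE /g turn_turn.
  by rewrite -cosD -sinD -splitr.
rewrite det_mulmx -expr2 det_orthogonal_sqr ?mulr1 //.
by apply: gram_mx_orthogonal => // i j; rewrite dot_turn // oe.
Qed.

End Turn.

(** * The rotation carrying one unit vector to another *)

Section Hat.
Variables (u w : V).
Hypotheses (uu : dot u u = 1) (ww : dot w w = 1) (uw : u != w) (uNw : u != - w).
Let a := hatv dot u w.
Let z := u - dot w u *: w.

Let z_neq0 : z != 0.
Proof.
apply/eqP => /eqP; rewrite subr_eq0 => /eqP E.
have : dot w u ^+ 2 = 1 by rewrite -[RHS]uu {2 3}E !dotE ww; ring.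
move/eqP; rewrite sqrf_eq1 => /orP[]/eqP c.
  by case/eqP: uw; rewrite E c scale1r.
by case/eqP: uNw; rewrite E c scaleN1r.
Qed.

Let nz : 0 < vnorm dot z. Proof. by rewrite vnorm_gt0. Qed.

Lemma hatv_unit : dot a a = 1.
Proof.
rewrite /a /hatv /normalize -/z dotZl dotZr -sqr_vnorm.
by field; rewrite gt_eqF.
Qed.

Lemma dot_hatv : dot w a = 0.
Proof. by rewrite /a /hatv /normalize !dotE ww; ring. Qed.

Lemma hatvE : u = dot a u *: a + dot w u *: w.
Proof.
suff -> : dot a u *: a = z by rewrite subrK.
have -> : dot a u = vnorm dot z.
  have -> : dot a u = dot a z by rewrite /z dotDr dotNr dotZr (dotC a w) dot_hatv mulr0 subr0.
  by rewrite /a /hatv /normalize -/z dotZl -sqr_vnorm; field; rewrite gt_eqF.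
by rewrite scalerA mulfV ?scale1r // gt_eqF.
Qed.

(** Hence the sign factor in [rot_angle] is 1 and the angle is [acos (dot w u)]. *)
Lemma dot_hatv_gt0 : 0 < dot a u.
Proof.
have -> : dot a u = dot a z by rewrite /z dotDr dotNr dotZr (dotC a w) dot_hatv mulr0 subr0.
by rewrite /a /hatv /normalize -/z dotZl mulr_gt0 ?invr_gt0 // dot_gt0.
Qed.

(** In the plane of [(a, w)] the vector [u] has coordinates [(sin T, cos T)], where [T] is the
    angle; turning by [T] gives [(0, 1)]. *)
Lemma rot_self : Defs.rot dot u w (rot_angle dot u w) u = w.
Proof.
have := dot_hatv_gt0; rewrite rot_turn /rot_angle -/a.
have := hatv_unit; have := hatvE; have := dot_hatv; rewrite -/a; clearbody a.
move: (dot a u) => s wa.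
set c := dot w u => E aa s0.
have sc : s ^+ 2 + c ^+ 2 = 1 by rewrite -uu E !dotE ww aa wa (dotC a w) wa; ring.
have c1 : -1 <= c <= 1.
  rewrite -ler_norml -(@expr_le1 _ 2) ?normr_ge0 // real_normK ?num_real //.
  by rewrite -sc lerDr sqr_ge0.
rewrite gtr0_norm // divff ?gt_eqF // mul1r sin_acos // acosK //.
have -> : Num.sqrt (1 - c ^+ 2) = s by rewrite -sc addrK sqrtr_sqr gtr0_norm.
rewrite /turn -/c.
have -> : dot a u = s by rewrite E !dotE aa (dotC a w) wa; ring.
rewrite {1}E -[_ + _ + _ *: w]addrA addrACA -!scalerDl.
have -> : s + ((c - 1) * s - s * c) = 0 by ring.
have -> : c + (s * s + (c - 1) * c) = s ^+ 2 + c ^+ 2 by ring.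
by rewrite sc scale1r scale0r add0r.
Qed.

End Hat.

(** * Orientation of orthonormal bases *)

Lemma nth_codom_ord k (u : 'I_k -> V) (i : 'I_k) : nth 0 (codom u) i = u i.
Proof. by rewrite codomE (nth_map i) ?size_enum_ord // nth_ord_enum. Qed.

Lemma size_codom_ord k (u : 'I_k -> V) : size (codom u) = k.
Proof. by rewrite size_codom card_ord. Qed.

Lemma orthonormal_nthP (s : seq V) : orthonormal dot s <->
  (forall i j, (i < size s)%N -> (j < size s)%N -> dot s`_i s`_j = (i == j)%:R).
Proof.
elim: s => [|x s IH]; first by split.
rewrite /orthonormal /= /ortho_rec /= andbT; split.
  move=> /andP[/andP[/eqP xx s1] /andP[/allP xs os]].
  have /(proj1 IH) {}IH : orthonormal dot s by rewrite /orthonormal s1 os.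
  case=> [|i] [|j] //=; rewrite !ltnS => hi hj.
  - exact/eqP/xs/mem_nth.
  - by rewrite dotC; apply/eqP/xs/mem_nth.
  - by rewrite IH.
move=> h; have /andP[s1 os] : orthonormal dot s.
  by apply/IH => i j hi hj; rewrite (h i.+1 j.+1).
have -> : dot x x = 1 by exact: (h 0%N 0%N).
rewrite eqxx s1 os !andbT /=; apply/allP => y ys /=.
by have := h 0%N (index y s).+1 isT; rewrite /= ltnS index_mem nth_index // => ->.
Qed.

Lemma is_ortho_onb W k (u : 'I_k -> V) : onb_of dot W u -> is_ortho u.
Proof.
move=> /andP[/orthonormal_nthP ou _] i j.
by have := ou i j; rewrite !size_codom_ord !nth_codom_ord !ltn_ord => ->.
Qed.

Lemma expands_span k (u : 'I_k -> V) x : is_ortho u -> x \in <<codom u>>%VS -> expands u x.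
Proof.
move=> ou xu; rewrite (coord_span (X := codom_tuple u) xu).
elim/big_ind: _ => [|y z|i _]; [|exact: expandsD|apply: expandsZ].
  by rewrite /expands big1 // => j _; rewrite dot0l scale0r.
have /codomP[j ->] : (codom_tuple u)`_i \in codom u by apply: mem_nth; rewrite size_tuple.
exact: expands_ortho.
Qed.

Lemma span_expands k (u : 'I_k -> V) x : expands u x -> x \in <<codom u>>%VS.
Proof.
move=> ->; apply: memv_suml => i _; apply: memvZ.
exact/memv_span/codom_f.
Qed.

Lemma is_ortho_free k (u : 'I_k -> V) : is_ortho u -> free (codom u).
Proof.
move=> ou; have -> : codom u = [tuple u i | i < k] by [].
apply/freeP => c c0 i; have := congr1 (dot (u i)) c0; rewrite dot0r dot_sumr.
rewrite (bigD1 i) //= nth_codom_ord dotZr ou eqxx mulr1 big1 ?addr0 // => j ji.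
by rewrite nth_codom_ord dotZr ou eq_sym (negbTE ji) mulr0.
Qed.

(** Translates the notion of basis quantified over in [orient_step] into the form used in the
    induction. Conversely, [k] free vectors inside a span of dimension at most [k] fill it. *)
Lemma onb_ofP k (e u : 'I_k -> V) : is_ortho e ->
  onb_of dot <<codom e>> u <-> is_ortho u /\ (forall i, expands e (u i)).
Proof.
move=> oe; split=> [ou|[ou eu]].
  split=> [|i]; first exact: is_ortho_onb ou.
  apply: expands_span => //; case/andP: ou => _ /span_basis <-.
  exact/memv_span/codom_f.
apply/andP; split.
  apply/orthonormal_nthP; rewrite size_codom_ord => i j hi hj.
  by rewrite (nth_codom_ord u (Ordinal hi)) (nth_codom_ord u (Ordinal hj)) ou.
rewrite basisEfree is_ortho_free //=; apply/andP; split.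
  by apply/span_subvP => _ /codomP[i ->]; apply: span_expands.
by rewrite size_codom_ord -{2}(size_codom_ord e) dim_span.
Qed.

Lemma det_mx22 (M : 'M[R]_2) : \det M = M 0 0 * M 1 1 - M 0 1 * M 1 0.
Proof.
rewrite (expand_det_row _ 0) !big_ord_recl big_ord0 addr0 /cofactor !det_mx11 !mxE.
have l1 : lift ord0 ord0 = 1 :> 'I_2 by apply: val_inj.
have l0 : lift 1 0 = 0 :> 'I_2 by apply: val_inj.
by rewrite !l1 l0 expr0 expr1 mul1r mulN1r mulrN.
Qed.

Lemma orient1_det (e u : 'I_1 -> V) : is_ortho e -> is_ortho u ->
  (forall i, expands e (u i)) -> (orient dot e u)%:~R = \det (gram_mx e u).
Proof.
move=> oe ou eu; have := det_orthogonal_sqr (gram_mx_orthogonal ou eu).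
rewrite det_mx11 mxE /=; have := eu ord0; rewrite /expands big_ord1.
set d := dot _ _ => E /eqP; rewrite sqrf_eq1 => /orP[]/eqP d1.
  by rewrite d1 E d1 scale1r eqxx.
rewrite d1 E d1 scaleN1r; case: eqP => // h.
have := oe ord0 ord0; rewrite -{1}h dotNl oe eqxx /= => h'; lra.
Qed.

(** With [u_1 = (p, q)] and [u_2 = (x, y)], the angle has cosine [y] and sine [x]. The rotated [u_1]
    then has first coordinate [p y - q x], the determinant, and second coordinate [x p + y q], which
    vanishes by orthogonality. *)
Lemma orient2_det (e u : 'I_2 -> V) : is_ortho e -> is_ortho u ->
  (forall i, expands e (u i)) -> (orient dot e u)%:~R = \det (gram_mx e u).
Proof.
move=> oe ou eu; have := det_orthogonal_sqr (gram_mx_orthogonal ou eu).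
have o1 : ord_max = 1 :> 'I_2 by apply: val_inj.
rewrite /= /orient2 o1 det_mx22 !mxE !(dotC (u _) (e _)).
have h i j : (i == j)%:R = dot (e 0) (u i) * dot (e 0) (u j) + dot (e 1) (u i) * dot (e 1) (u j).
  rewrite -ou (dot_expands _ (eu i)) !big_ord_recl big_ord0 addr0.
  have -> : lift ord0 ord0 = 1 :> 'I_2 by apply: val_inj.
  by rewrite !(dotC (u _) (e _)).
set p := dot (e 0) (u 0); set q := dot (e 1) (u 0).
set x := dot (e 0) (u 1); set y := dot (e 1) (u 1).
move=> hd.
have h11 : x * x + y * y = 1 := esym (h 1 1).
have h01 : p * x + q * y = 0 := esym (h 0 1).
(* Only [s = 1] or [s = -1] and [s |x| = x] are used below; at [x = 0] both signs satisfy them. *)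
pose s : R := if x == 0 then 1 else x / `|x|; rewrite -/s.
have [s1 sx] : (s = 1 \/ s = -1) /\ s * `|x| = x.
  rewrite /s; case: (ltrgt0P x) => x0.
  - by rewrite divff ?gt_eqF // mul1r; split; [left|].
  - by rewrite invrN mulrN divff ?lt_eqF // mulN1r opprK; split; [right|].
  - by rewrite x0 mulr0; split; [left|].
have y1 : -1 <= y <= 1.
  rewrite -ler_norml -(@expr_le1 _ 2) ?normr_ge0 // real_normK ?num_real //.
  by rewrite -h11 -!expr2 lerDr sqr_ge0.
have -> : cos (s * acos y) = y.
  by case: s1 => ->; rewrite ?mul1r ?mulN1r ?cosN acosK.
have -> : sin (s * acos y) = x.
  have sy : sin (acos y) = `|x|.
    by rewrite sin_acos // -h11 -!expr2 addrK sqrtr_sqr.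
  by rewrite -[RHS]sx; case: s1 => ->; rewrite ?mul1r ?mulN1r ?sinN sy.
have -> : x * p + y * q = 0 by rewrite mulrC (mulrC y).
rewrite scale0r addr0.
have -> : y * p - x * q = p * y - q * x by ring.
move/eqP: hd; rewrite sqrf_eq1 => /orP[]/eqP ->; first by rewrite scale1r eqxx.
rewrite scaleN1r; case: eqP => // he.
have := oe 0 0; rewrite -{1}he dotNl oe eqxx /= => h'; lra.
Qed.

(** * The inductive step: general position, then degenerate bases *)

Lemma det_last_row k (A : 'M[R]_k.+1) :
  (forall j, A ord_max j = (j == ord_max)%:R) ->
  \det A = \det (\matrix_(i < k, j < k)
     A (widen_ord (leqnSn k) i) (widen_ord (leqnSn k) j)).
Proof.
move=> Amax; rewrite (expand_det_row _ ord_max) (bigD1 ord_max) //= big1 ?addr0.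
  rewrite Amax eqxx mul1r /cofactor addnn -signr_odd odd_double expr0 mul1r.
  congr (\det _); apply/matrixP => i j; rewrite !mxE.
  by congr (A _ _); apply: val_inj; rewrite /= /bump leqNgt ltn_ord.
by move=> j jm; rewrite Amax (negbTE jm) mul0r.
Qed.

Lemma orient_generic_det k (S : ('I_k -> V) -> ('I_k -> V) -> int) (e u : 'I_k.+1 -> V) :
  (forall e' u' : 'I_k -> V, is_ortho e' -> is_ortho u' ->
    (forall i, expands e' (u' i)) -> (S e' u')%:~R = \det (gram_mx e' u')) ->
  is_ortho e -> is_ortho u -> (forall i, expands e (u i)) ->
  in_general_position e u ->
  (orient_generic dot S e u)%:~R = \det (gram_mx e u).
Proof.
move=> HS oe ou eu /andP[ne nNe].
set un := u ord_max in ne nNe *; set en := e ord_max in ne nNe *.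
have uu : dot un un = 1 by rewrite ou eqxx.
have ww : dot en en = 1 by rewrite oe eqxx.
have aa := hatv_unit uu ww ne nNe; have wa := dot_hatv un ww.
pose r v := Defs.rot dot un en (rot_angle dot un en) v.
have r_dot x y : dot (r x) (r y) = dot x y by rewrite /r !rot_turn dot_turn ?cos2Dsin2.
have r_un : r un = en := rot_self uu ww ne nNe.
have ea : expands e (hatv dot un en).
  by apply: expandsZ; apply: expandsB; [exact: eu|apply: expandsZ; exact: expands_ortho].
have er v : expands e v -> expands e (r v).
  by move=> ev; rewrite /r rot_turn; apply: expands_turn => //; apply: expands_ortho.
have -> : \det (gram_mx e u) = \det (gram_mx e (fun i => r (u i))).
  rewrite -(det_gram_mx_turn aa ww wa (rot_angle dot un en) oe ea _ eu); last exact: expands_ortho.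
  by congr (\det _); apply/matrixP => i j; rewrite !mxE /r rot_turn.
rewrite det_last_row; last by move=> j; rewrite mxE r_un oe eq_sym.
rewrite /orient_generic -/un -/en HS.
- by congr (\det _); apply/matrixP => i j; rewrite !mxE.
- by move=> i j; rewrite /initv oe.
- by move=> i j; rewrite r_dot /initv ou.
(* The rotation preserves dot products and sends [u_n] to [e_n], so the other rotated vectors are
   orthogonal to [e_n] and their expansions lose the last term. *)
move=> i; have := er _ (eu (widen_ord (leqnSn k) i)).
rewrite {1}/expands big_ord_recr /=.
have -> : dot (r (u (widen_ord (leqnSn k) i))) (e ord_max) = 0.
  by rewrite -/en -r_un r_dot ou -val_eqE /= ltn_eqF.
by rewrite scale0r addr0.
Qed.

(** The transition matrix [gram_mx u u'] is orthogonal, and by Cauchy-Schwarz its entries are within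
    [1 / k] of those of the identity, so its determinant is 1. *)
Lemma gram_mx_near k (e u u' : 'I_k -> V) : is_ortho u -> is_ortho u' ->
  (forall i, expands e (u i)) -> (forall i, expands e (u' i)) ->
  (forall i, vnorm dot (u' i - u i) < k%:R^-1) ->
  \det (gram_mx e u') = \det (gram_mx e u).
Proof.
move=> ou ou' eu eu' near.
have H : gram_mx u u' = gram_mx e u' *m (gram_mx e u)^T.
  by rewrite gram_mx_tr -gram_mx_chain.
have dQ : \det (gram_mx u u') = 1.
  apply: det_orthogonal_near1 => [|i j].
    rewrite H trmx_mul trmxK mulmxA -(mulmxA (gram_mx e u')).
    have /mulmx1C -> := gram_mx_orthogonal ou eu.
    by rewrite mulmx1 gram_mx_orthogonal.
  rewrite mxE -ou -dotBl (le_lt_trans (cauchy_schwarz_dot _ _)) //.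
  by rewrite {2}/vnorm ou eqxx sqrtr1 mulr1.
have := det_orthogonal_sqr (gram_mx_orthogonal ou eu).
move: dQ; rewrite H det_mulmx det_tr expr2 => dQ du.
by rewrite -[LHS]mulr1 -du mulrA dQ mul1r.
Qed.

(** A small rotation in the plane of the first and last vectors of [u] suffices. In the degenerate
    case [u_0] is orthogonal to the last vector of [e], whereas the rotated last vector has dot
    product [-s], nonzero, with [u_0]. *)
Lemma near_general_position k (e u : 'I_k.+2 -> V) (eps : R) :
  is_ortho e -> is_ortho u -> (forall i, expands e (u i)) -> 0 < eps ->
  ~~ in_general_position e u ->
  exists u' : 'I_k.+2 -> V, [/\ is_ortho u', (forall i, expands e (u' i)),
    in_general_position e u' & forall i, vnorm dot (u' i - u i) < eps].
Proof.
move=> oe ou eu eps0 ngp.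
set a := u ord0; set w := u ord_max.
have aa : dot a a = 1 by rewrite ou eqxx.
have ww : dot w w = 1 by rewrite ou eqxx.
have wa : dot w a = 0 by rewrite ou.
pose r := eps / 3; have r0 : 0 < r by rewrite divr_gt0.
(* Rational parametrization of the circle. The squared chord [2 - 2c = 4 r^2 / (1 + r^2)] is below
   [9 r^2 = eps^2], which is why [r = eps / 3]. *)
pose c := (1 - r ^+ 2) / (1 + r ^+ 2); pose s := 2 * r / (1 + r ^+ 2).
have r1 : 1 + r ^+ 2 != 0 by rewrite gt_eqF // ltr_wpDr ?sqr_ge0.
have cs : c ^+ 2 + s ^+ 2 = 1 by rewrite /c /s; field.
have s0 : s != 0 by rewrite /s; apply: mulf_neq0; [apply: mulf_neq0; rewrite ?gt_eqF|rewrite invr_neq0].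
exists (fun i => turn a w c s (u i)); split => [i j|i| |i].
- by rewrite dot_turn.
- by apply: expands_turn; apply: eu.
- have aw : dot a (turn a w c s w) = - s.
    by rewrite dot_turn_l // (dotC a w) wa ww; ring.
  have ae : dot a (e ord_max) = 0.
    move: ngp; rewrite negb_and !negbK -/w => /orP[]/eqP E.
      by rewrite -E dotC.
    by rewrite -[e _]opprK -E dotNr dotC wa oppr0.
  rewrite /in_general_position -/w; apply/andP; split; apply/eqP => E.
    by move: aw; rewrite E ae => /eqP; rewrite eq_sym oppr_eq0 (negbTE s0).
  by move: aw; rewrite E dotNr ae oppr0 => /eqP; rewrite eq_sym oppr_eq0 (negbTE s0).
rewrite -ltr_sqr ?nnegrE ?vnorm_ge0 ?(ltW eps0) // sqr_dist_turn //.
have : dot a (u i) ^+ 2 + dot w (u i) ^+ 2 <= 1.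
  rewrite !ou; case: (eqVneq ord0 i) => [<-|_] /=.
    by rewrite expr1n expr0n addr0.
  by rewrite expr0n add0r; case: eqP; rewrite /= ?expr1n ?expr0n.
have h2 : 2 - 2 * c = 4 * r ^+ 2 / (1 + r ^+ 2) by rewrite /c; field.
have r1_gt0 : 0 < 1 + r ^+ 2 by rewrite ltr_wpDr ?sqr_ge0.
have h3 : 0 <= 2 - 2 * c < eps ^+ 2.
  rewrite h2; apply/andP; split.
    by apply: divr_ge0; [apply: mulr_ge0; rewrite ?sqr_ge0|exact: ltW].
  rewrite ltr_pdivrMr //.
  have -> : eps = 3 * r by rewrite /r; field.
  by have := exprn_gt0 2 r0; nra.
case/andP: h3 => h3 h4 h5; apply: le_lt_trans h4.
by rewrite -[leRHS]mulr1 ler_wpM2l.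
Qed.

Lemma orient_step_det k (S : ('I_k.+1 -> V) -> ('I_k.+1 -> V) -> int) (e u : 'I_k.+2 -> V) :
  (forall e' u' : 'I_k.+1 -> V, is_ortho e' -> is_ortho u' ->
    (forall i, expands e' (u' i)) -> (S e' u')%:~R = \det (gram_mx e' u')) ->
  is_ortho e -> is_ortho u -> (forall i, expands e (u i)) ->
  (orient_step dot S e u)%:~R = \det (gram_mx e u).
Proof.
move=> HS oe ou eu; rewrite /orient_step.
case: ifPn => gp; first exact: orient_generic_det.
set P := [set s | _]%classic.
have n0 : 0 < k.+2%:R^-1 :> R by rewrite invr_gt0 ltr0n.
have P_det s : P s -> s%:~R = \det (gram_mx e u).
  case=> eps eps0 h.
  (* Within [eps] the value is [s] by assumption; within [1 / (k + 2)] the determinant is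
     constant. *)
  have m0 : 0 < Num.min eps k.+2%:R^-1 by rewrite lt_min eps0.
  have [u' [ou' eu' gp' near]] := near_general_position oe ou eu m0 gp.
  rewrite -(h u') //; last by move=> i; have := near i; rewrite lt_min => /andP[].
    rewrite orient_generic_det //; apply: gram_mx_near => // i.
    by have := near i; rewrite lt_min => /andP[].
  exact/onb_ofP.
have [u0 [ou0 eu0 gp0 near0]] := near_general_position oe ou eu n0 gp.
(* The set is inhabited, so [xget] returns one of its elements and not the default 0. *)
have Ps : P (orient_generic dot S e u0).
  exists k.+2%:R^-1 => // u' /(onb_ofP _ oe)[ou' eu'] gp' near.
  apply: (@intr_inj R); rewrite !orient_generic_det //.
  by rewrite (gram_mx_near ou ou' eu eu' near) (gram_mx_near ou ou0 eu eu0 near0).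
by apply: P_det; apply: xgetPex; eexists; exact: Ps.
Qed.

Lemma orient_det k (e u : 'I_k -> V) : is_ortho e -> is_ortho u ->
  (forall i, expands e (u i)) -> (orient dot e u)%:~R = \det (gram_mx e u).
Proof.
elim: k e u => [|[|[|k]] IH] e u.
- by move=> *; rewrite det_mx00.
- exact: orient1_det.
- exact: orient2_det.
- exact: orient_step_det.
Qed.

(** * Gram-Schmidt orthonormalization *)

(** The last two clauses make the change of basis from [us] to [s] triangular with positive
    diagonal. Induction from the right end follows the [foldl]. *)
Lemma gram_schmidt_seq_spec (s : seq V) : free s ->
  let us := gram_schmidt_seq dot s in
  [/\ size us = size s, orthonormal dot us, <<us>>%VS = span s,
    forall i, (i < size s)%N -> 0 < dot s`_i us`_i &
    forall i j, (j < i < size s)%N -> dot s`_j us`_i = 0].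
Proof.
elim/last_ind: s => [|s x IH]; first by split=> // i j /andP[].
rewrite (perm_free (permEl (perm_rcons _ _))) free_cons => /andP[xs /IH].
rewrite /gram_schmidt_seq -cats1 foldl_cat cats1 /= -/(gram_schmidt_seq dot s).
set us := gram_schmidt_seq dot s => -[su ou eus pos tri].
set p := \sum_(u <- us) _; set z := x - p; set y := normalize dot z.
have pus : p \in <<us>>%VS.
  by rewrite /p big_seq; apply: memv_suml => u uus; apply/memvZ/memv_span.
have z0 : z != 0 by rewrite subr_eq0; apply: contraNneq xs => ->; rewrite -eus.
have nz : 0 < vnorm dot z by rewrite vnorm_gt0.
have zE : z = vnorm dot z *: y by rewrite scalerA mulfV ?scale1r // gt_eqF.
have zus k : (k < size us)%N -> dot z us`_k = 0.
  move=> hk; rewrite dotBl /p (big_nth 0) big_mkord dot_suml (bigD1 (Ordinal hk)) //=.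
  have /orthonormal_nthP o := ou; rewrite dotZl o // eqxx mulr1 big1 ?addr0 ?subrr // => i ik.
  by rewrite dotZl o //= (_ : (i == k :> nat) = false) ?mulr0 //; apply: negbTE.
have yus v : v \in <<us>>%VS -> dot y v = 0.
  move=> vu; rewrite (coord_span (X := in_tuple us) vu) dot_sumr big1 // => i _.
  by rewrite dotZr dotZl zus ?mulr0.
have yy : dot y y = 1 by rewrite dotZl dotZr -sqr_vnorm; field; rewrite gt_eqF.
split.
- by rewrite !size_rcons su.
- apply/orthonormal_nthP => i j; rewrite size_rcons !ltnS !nth_rcons => hi hj.
  have /orthonormal_nthP o := ou; move: hi hj.
  case: (ltngtP i (size us)) => // [hi _|-> _]; last first.
    by case: (ltngtP j (size us)) => // hj _; rewrite yus // memv_span ?mem_nth.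
  case: (ltngtP j (size us)) => // [hj _|-> _]; first exact: o.
  by rewrite dotC yus ?memv_span ?mem_nth // ltn_eqF.
- rewrite -!cats1 !span_cat !span_seq1 eus; apply/eqP; rewrite eqEsubv !subv_add !addvSl /=.
  rewrite -!memvE; apply/andP; split.
    by apply/memvZ/memvB; [exact/(subvP (addvSr _ _))/memv_line|rewrite -eus (subvP (addvSl _ _))].
  rewrite -[x](subrK p) -/z zE; apply: memvD.
    by apply/memvZ/(subvP (addvSr _ _))/memv_line.
  by rewrite -eus (subvP (addvSl _ _)).
- move=> i; rewrite size_rcons ltnS !nth_rcons su; case: (ltngtP i) => // [hi _|_ _].
    exact: pos.
  by rewrite -{1}[x](subrK p) -/z dotDl (dotC p) yus // addr0 zE dotZl yy mulr1.
- move=> i j; rewrite size_rcons ltnS !nth_rcons su => /andP[ji].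
  case: (ltngtP i) => // [hi _|ei _]; first by rewrite (ltn_trans ji hi) tri ?ji.
  by rewrite -ei ji dotC yus // eus memv_span // mem_nth // -ei.
Qed.

(** The matrix of [v] in [e] is the triangular matrix of [v] in its orthonormalization, of positive
    determinant, times an orthogonal matrix, of determinant 1 or -1. *)
Lemma onb_of_gram_schmidt k (e v : 'I_k -> V) : onb_of dot fullv e ->
  basis_of fullv (codom v) ->
  [/\ is_ortho (gram_schmidt dot v), \det (gram_mx e v) != 0 &
    \det (gram_mx e (gram_schmidt dot v)) = Num.sg (\det (gram_mx e v))].
Proof.
move=> eo /andP[/eqP vfull vfree].
have [su ou eus pos tri] := gram_schmidt_seq_spec vfree.
set u := gram_schmidt dot v; rewrite size_codom_ord in su pos tri.
have uE : codom u = gram_schmidt_seq dot (codom v).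
  apply: (@eq_from_nth _ 0); rewrite ?size_codom_ord ?su // => i hi.
  by rewrite (nth_codom_ord u (Ordinal hi)).
have oru : is_ortho u by move=> i j; move/orthonormal_nthP: ou => ->; rewrite ?su.
have eu x : expands u x by apply: expands_span => //; rewrite uE eus vfull memvf.
have ee x : expands e x.
  apply: expands_span; first exact: is_ortho_onb eo.
  by case/andP: eo => _ /span_basis ->; rewrite memvf.
have Dpos : 0 < \det (gram_mx u v).
  rewrite det_trig; last first.
    apply/is_trig_mxP => i j ij; rewrite mxE.
    by have := tri j i; rewrite nth_codom_ord ij ltn_ord => ->.
  by apply: prodr_gt0 => i _; rewrite mxE; have := pos i; rewrite nth_codom_ord; apply.
rewrite (gram_mx_chain (e := u) e) // det_mulmx sgrM (gtr0_sg Dpos) mul1r.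
have := det_orthogonal_sqr (gram_mx_orthogonal oru (fun i => ee (u i))).
move/eqP; rewrite sqrf_eq1 => /orP[]/eqP ->.
  by rewrite sgr1 mulr1 gt_eqF.
by rewrite sgrN sgr1 mulrN1 oppr_eq0 gt_eqF.
Qed.

Lemma orientationE k (e v : 'I_k -> V) : onb_of dot fullv e ->
  basis_of fullv (codom v) ->
  (orientation dot e v)%:~R = Num.sg (\det (gram_mx e v)).
Proof.
move=> eo bv; have [ou _ <-] := onb_of_gram_schmidt eo bv.
have oe := is_ortho_onb eo; apply: orient_det => // i.
by apply: expands_span => //; case/andP: eo => _ /span_basis ->; rewrite memvf.
Qed.

Lemma basis_of_det k (e v : 'I_k -> V) : onb_of dot fullv e ->
  basis_of fullv (codom v) = (\det (gram_mx e v) != 0).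
Proof.
move=> eo; apply/idP/idP => [bv|d0]; first by have [] := onb_of_gram_schmidt eo bv.
have : free (codom v).
  have -> : codom v = [tuple v i | i < k] by [].
  apply/freeP => c c0.
  suff : (\row_i c i) *m gram_mx e v = 0.
    move/(congr1 (mulmxr (invmx (gram_mx e v)))).
    rewrite /= mulmxK ?unitmxE ?unitfE // mul0mx => /matrixP E i.
    by have := E 0 i; rewrite !mxE.
  apply/matrixP => i j; rewrite !mxE -[RHS](dot0l (e j)) -c0 dot_suml.
  by apply: eq_bigr => l _; rewrite !mxE nth_codom_ord dotZl.
rewrite basisEfree subvf size_codom_ord => -> /=.
by case/andP: eo => _ /size_basis ->; rewrite card_ord.
Qed.

End Orientation.

(** * Volume *)

(** The Cauchy functional equation: nonnegativity makes [g] monotone, and monotonicity upgrades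
    homogeneity over positive integers to homogeneity over positive reals. *)
Lemma ereal_additive_linear (R : realType) (g : R -> \bar R) :
  (forall t, 0 < t -> (0 <= g t)%E) ->
  (forall s t, 0 < s -> 0 < t -> g (s + t) = (g s + g t)%E) ->
  forall t, 0 < t -> fine (g t) = t * fine (g 1).
Proof.
move=> g0 gD.
have mono s t : 0 < s -> s <= t -> (g s <= g t)%E.
  move=> s0; rewrite le_eqVlt => /orP[/eqP-> //|st].
  by rewrite -(subrK s t) addrC gD ?subr_gt0 // leeDl // g0 // subr_gt0.
have gM n t : 0 < t -> g (n.+1%:R * t) = (n.+1%:R%:E * g t)%E.
  move=> t0; elim: n => [|n IH]; first by rewrite mul1r mul1e.
  rewrite -(addn1 n.+1) natrD mulrDl mul1r gD // ?mulr_gt0 // IH EFinD.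
  by rewrite ge0_muleDl ?lee_fin // mul1e.
have big (x : R) : exists n : nat, x < n.+1%:R.
  exists (Num.bound `|x|); apply: le_lt_trans (ler_norm x) _.
  by apply: lt_trans (archi_boundP (normr_ge0 x)) _; rewrite ltr_nat.
(* If [g 1] is infinite, so is every [g t], since some multiple of [t] exceeds 1; [fine] sends [+oo]
   to 0 and both sides vanish. *)
have [f1|i1] := boolP (g 1 \is a fin_num); last first.
  move=> t t0; have g1 : g 1 = +oo%E.
    by move: i1 (g0 1 ltr01); rewrite fin_numE; case: (g 1).
  suff -> : g t = +oo%E by rewrite g1 /= mulr0.
  have [n tn] := big t^-1.
  have := mono _ (n.+1%:R * t) ltr01; rewrite -ler_pdivrMr // div1r (ltW tn) g1 gM // => /(_ isT).
  by rewrite leye_eq => /eqP; move: (g0 t t0); case: (g t) => //= r; rewrite -EFinM.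
have fg t : 0 < t -> g t \is a fin_num.
  move=> t0; have [n tn] := big t; rewrite ge0_fin_numE ?g0 //.
  apply: le_lt_trans (mono _ _ t0 (ltW tn)) _.
  by rewrite -[n.+1%:R]mulr1 gM // -(fineK f1) -EFinM ltry.
pose h t := fine (g t).
have h0 t : 0 < t -> 0 <= h t by move=> t0; rewrite fine_ge0 ?g0.
have hmono s t : 0 < s -> s <= t -> h s <= h t.
  by move=> s0 st; rewrite fine_le ?fg ?mono // (lt_le_trans s0).
have hM n t : 0 < t -> h (n.+1%:R * t) = n.+1%:R * h t.
  by move=> t0; rewrite /h gM // fineM ?fg.
move=> t t0; rewrite -/(h t) -/(h 1); apply/eqP; rewrite -subr_eq0 -normr_le0 leNgt.
(* The defect at [x = (n + 1) t] is [n + 1] times the defect at [t], yet trapping [x] between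
   consecutive integers bounds it by [h 1] for every [n]. *)
apply/negP => d0; have [n] := big (h 1 / `|h t - t * h 1|).
rewrite ltr_pdivrMr // ltNge => /negP; apply.
rewrite -[n.+1%:R]ger0_norm // -normrM mulrBr -hM // mulrA.
set x := n.+1%:R * t; have x0 : 0 < x by rewrite mulr_gt0.
have /andP[kx xk] := truncn_itv (ltW x0).
have up : h x <= (Num.truncn x).+1%:R * h 1.
  by rewrite -hM // mulr1; apply: hmono => //; apply: ltW.
have lo : (Num.truncn x)%:R * h 1 <= h x.
  (* [hM] covers positive multiples; the integer part 0 is handled by nonnegativity of [h]. *)
  case: (Num.truncn x) kx => [|k] kx; first by rewrite mul0r h0.
  by rewrite -hM // mulr1; apply: hmono.
move: up xk; rewrite -natr1; move: lo kx (h0 1 ltr01); move: (_%:R) => k lo kx h1 up xk.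
by rewrite ler_norml; apply/andP; split; nra.
Qed.

Section Volume.
Context {R : realType} {V : vectType R}.
Variables (dot : {dot V for @idfun R}) (n : nat) (e : 'I_n -> V).
Hypothesis e_onb : onb_of dot fullv e.
Local Open Scope classical_set_scope.

(** Riesz vectors of the coordinate functionals of [v]. They turn membership in a parallelepiped
    into inequalities between dot products. *)
Lemma dual_family (v : 'I_n -> V) : basis_of fullv (codom v) ->
  exists w : 'I_n -> V, (forall i j, dot (w i) (v j) = (i == j)%:R) /\
    forall x, x = \sum_i dot (w i) x *: v i.
Proof.
have -> : codom v = [tuple v i | i < n] by [].
set X := [tuple v i | i < n] => bX.
pose w i := \sum_j coord X i (e j) *: e j.
have ee x : expands dot e x.
  apply: expands_span; first exact: is_ortho_onb e_onb.
  by case/andP: e_onb => _ /span_basis ->; rewrite memvf.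
have wE i x : dot (w i) x = coord X i x.
  rewrite {2}(ee x) linear_sum dot_suml; apply: eq_bigr => j _.
  by rewrite linearZ /= dotZl (dotC _ x) mulrC.
have Xi (i : 'I_n) : X`_i = v i by rewrite -(nth_codom_ord v).
exists w; split=> [i j|x].
  by rewrite wE -Xi coord_free ?(basis_free bX) // eq_sym.
rewrite {1}(coord_basis bX (memvf x)); apply: eq_bigr => i _.
by rewrite wE Xi.
Qed.

(** By Cauchy-Schwarz the preimages of the rays []-oo, a[], which generate the Borel sets of the
    line, are open. *)
Lemma measurable_dot (w : V) : measurable_fun setT (dot w : borel dot -> R).
Proof.
apply: (measurability _ (measurable_realfun.RGenInftyO.measurableE R)) => //.
move=> _ [_ [a ->] <-]; rewrite setTI; apply: sub_sigma_algebra => x /=.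
(* Adding 1 keeps the denominator of the radius positive when [w = 0]. *)
have n0 : 0 < vnorm dot w + 1 by rewrite ltr_wpDl ?vnorm_ge0.
rewrite in_itv /= => xa; exists ((a - dot w x) / (vnorm dot w + 1)).
  by rewrite divr_gt0 ?subr_gt0.
move=> y; rewrite ltr_pdivlMr // => yx.
rewrite in_itv /=; have := cauchy_schwarz_dot dot w (y - x); rewrite dotBr.
have := ler_norm (dot w y - dot w x); have := vnorm_ge0 dot (y - x); nra.
Qed.

(** With [w] dual to a basis, a product of [A] in direction [i] and unit intervals in the others.
    Its measure becomes a translation-invariant, additive function of the subset [A] of the line. *)
Definition slab (w : 'I_n -> V) (i : 'I_n) (A : set R) : set (borel dot) :=
  [set x : V | A (dot (w i) x) /\ forall k, k != i -> 0 <= dot (w k) x < 1].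

Lemma measurable_slab w i A : measurable A -> measurable (slab w i A).
Proof.
move=> mA.
have -> : slab w i A = (dot (w i) : borel dot -> R) @^-1` A `&`
    \bigcap_(k in [set k | k != i]) (dot (w k) : borel dot -> R) @^-1` `[0, 1[.
  by apply/seteqP; split => x [xA xk]; split => // k ki; have := xk k ki; rewrite /= in_itv.
apply: measurableI.
  by rewrite -[X in measurable X]setTI; apply: measurable_dot.
apply: fin_bigcap_measurable => [|k _]; first exact: finite_finset.
by rewrite -[X in measurable X]setTI; apply: measurable_dot.
Qed.

Lemma translate_slab (w v : 'I_n -> V) i (t : R) (A : set R) :
  (forall k, dot (w k) (v i) = (k == i)%:R) ->
  [set (t *: v i + x : V) | x in slab w i A] = slab w i [set t + s | s in A].
Proof.
move=> wv; apply/seteqP; split => [_ [x [xA xk] <-]|x [[s As sx] xk]].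
  split; first by exists (dot (w i) x); rewrite // dotDr dotZr wv eqxx mulr1.
  by move=> k ki; rewrite dotDr dotZr wv (negbTE ki) mulr0 add0r xk.
exists (x - t *: v i); last by rewrite addrC subrK.
split=> [|k ki]; rewrite dotBr dotZr wv.
  by rewrite eqxx mulr1 -sx addrC addKr.
by rewrite (negbTE ki) mulr0 subr0 xk.
Qed.

Lemma parallelepiped_dual (w v : 'I_n -> V) :
  (forall i j, dot (w i) (v j) = (i == j)%:R) ->
  (forall x, x = \sum_i dot (w i) x *: v i) ->
  parallelepiped v = [set x | forall k, 0 <= dot (w k) x < 1].
Proof.
move=> wv vE; apply/seteqP; split => [_ [t t01 ->] k|x xk]; last by exists (fun k => dot (w k) x).
rewrite dot_sumr (bigD1 k) //= dotZr wv eqxx mulr1 big1 ?addr0 // => j jk.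
by rewrite dotZr wv eq_sym (negbTE jk) mulr0.
Qed.

(** The dual family of the scaled basis has [w i] divided by [t]; writing the condition as
    [0 <= s / t < 1] covers both signs of [t]. *)
Lemma parallelepiped_scale (w v : 'I_n -> V) (t : R) (i : 'I_n) :
  (forall i j, dot (w i) (v j) = (i == j)%:R) ->
  (forall x, x = \sum_i dot (w i) x *: v i) -> t != 0 ->
  parallelepiped (fun k => if k == i then t *: v i else v k) =
  slab w i [set s : R | 0 <= s / t < 1].
Proof.
move=> wv vE t0; pose w' k := if k == i then t^-1 *: w i else w k.
rewrite (parallelepiped_dual (w := w')).
- apply/seteqP; split=> x /=.
    move=> h; split=> [|k ki]; first by have := h i; rewrite /w' eqxx dotZl mulrC.
    by have := h k; rewrite /w' (negbTE ki).
  move=> [hi hk] k; rewrite /w'; case: eqP => [_|/eqP]; last exact: hk.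
  by rewrite dotZl mulrC.
- move=> k l; rewrite /w' /=; have [->|ki] := eqVneq k i; have [li|li] := eqVneq l i.
  + by rewrite dotZl dotZr wv eqxx mulr1 mulVf.
  + by rewrite dotZl wv eq_sym (negbTE li) mulr0.
  + by rewrite li dotZr wv (negbTE ki) mulr0.
  + exact: wv.
move=> x; rewrite {1}(vE x); apply: eq_bigr => k _; rewrite /w'; case: eqP => // ->.
by rewrite dotZl scalerA mulrC mulrA mulfV // mul1r.
Qed.

Variable mu : {measure set (borel dot) -> \bar R}.
Hypothesis mu_translation : forall (a : V) (A : set (borel dot)),
  measurable A -> mu [set (a + x : V) | x in A] = mu A.

Lemma mu_slab_translate (w v : 'I_n -> V) i (t : R) (A : set R) :
  (forall k, dot (w k) (v i) = (k == i)%:R) -> measurable A ->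
  mu (slab w i [set t + s | s in A]) = mu (slab w i A).
Proof.
move=> wv mA; rewrite -(translate_slab t A wv) mu_translation //.
exact: measurable_slab.
Qed.

Lemma mu_slabU w i (A B : set R) : measurable A -> measurable B -> A `&` B = set0 ->
  mu (slab w i (A `|` B)) = (mu (slab w i A) + mu (slab w i B))%E.
Proof.
move=> mA mB AB.
have -> : slab w i (A `|` B) = slab w i A `|` slab w i B.
  apply/seteqP; split => x; first by case=> -[xA|xB] xk; [left|right].
  by case=> -[xA xk]; split => //; [left|right].
rewrite measureU //; [exact: measurable_slab|exact: measurable_slab|].
by apply/seteqP; split => // x [[xA _] [xB _]]; have : (A `&` B) (dot (w i) x) by []; rewrite AB.
Qed.

(** * Volume under scaling and shearing *)

Lemma vol_scale (v : 'I_n -> V) (t : R) (i : 'I_n) : basis_of fullv (codom v) -> t != 0 ->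
  vol mu (fun k => if k == i then t *: v i else v k) = `|t| * vol mu v.
Proof.
move=> bv t0; have [w [wv vE]] := dual_family bv.
pose m (A : set R) := mu (slab w i A).
have mD (s : R) (A : set R) : measurable A -> m [set s + x | x in A] = m A.
  by apply: (mu_slab_translate (v := v)) => k.
have shift_itv (b1 b2 : bool) (s x y : R) :
    [set s + z | z in [set` Interval (BSide b1 x) (BSide b2 y)]] =
    [set` Interval (BSide b1 (s + x)) (BSide b2 (s + y))].
  apply/seteqP; split => [_ [z + <-]|z]; rewrite /= !in_itv /=.
    by case: b1; case: b2; rewrite /= ?lerD2l ?ltrD2l.
  move=> h; exists (z - s); last by rewrite addrC subrK.
  rewrite /= in_itv /=; move: h; case: b1; case: b2 => /=;
  by rewrite ?lerBrDl ?ltrBrDl ?lerBlDl ?ltrBlDl.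
have scaleE (u : R) : u != 0 -> vol mu (fun k => if k == i then u *: v i else v k) =
    fine (m [set s : R | 0 <= s / u < 1]).
  by move=> u0; rewrite /vol (parallelepiped_scale i wv vE u0).
have posE (u : R) : 0 < u -> [set s : R | 0 <= s / u < 1] = `[0, u[.
  move=> u0; apply/seteqP; split => s; rewrite /= in_itv /=;
  by rewrite ler_pdivlMr // mul0r ltr_pdivrMr // mul1r.
have negE (u : R) : u < 0 -> [set s : R | 0 <= s / u < 1] = `]u, 0].
  move=> u0; apply/seteqP; split => s; rewrite /= in_itv /=;
  by rewrite ler_ndivlMr // mul0r ltr_ndivrMr // mul1r andbC.
have addE (s u : R) : 0 < s -> 0 < u -> m `[0, s + u[ = (m `[0%R, s[%classic + m `[0%R, u[%classic)%E.
  move=> s0 u0; rewrite -(mD s `[0, u[) // shift_itv addr0 -mu_slabU //.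
    congr (mu (slab w i _)); apply/seteqP; split=> x; rewrite /= !in_itv /=.
      case/andP=> x0 xs; have [xs'|xs'] := ltP x s; [left|right]; exact/andP.
    case=> /andP[x0 xs]; apply/andP; split=> //.
    - by apply: (lt_trans xs); rewrite ltrDl.
    - exact: le_trans (ltW s0) x0.
  apply/seteqP; split => // x []; rewrite /= !in_itv /= => /andP[_ h1] /andP[h2 _].
  by have := lt_le_trans h1 h2; rewrite ltxx.
have vol1 : vol mu v = fine (m `[0, 1[).
  rewrite -posE // -scaleE ?oner_neq0 //; congr (vol mu _); apply/funext => k.
  by case: eqP => // ->; rewrite scale1r.
have pos_scale (u : R) : 0 < u -> fine (m `[0, u[) = u * vol mu v.
  by move=> u0; rewrite vol1; apply: (ereal_additive_linear (g := fun u => m `[0, u[)).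
(* Both intervals are []0, u[] with one endpoint added, and the slabs over the endpoints are
   translates of each other. *)
have face (u : R) : 0 < u -> m `[0, u[ = m `]0, u].
  move=> u0.
  have U1 : `[0, u[ = [set 0] `|` `]0, u[ by rewrite setU1itv ?bnd_simp.
  have U2 : `]0, u] = [set u] `|` `]0, u[.
    by rewrite setUC setUitv1 ?bnd_simp.
  have D1 : [set 0] `&` `]0, u[ = set0 :> set R.
    by apply/seteqP; split=> // x [/= ->]; rewrite in_itv /= ltxx.
  have D2 : [set u] `&` `]0, u[ = set0 :> set R.
    by apply/seteqP; split=> // x [/= ->]; rewrite in_itv /= ltxx andbF.
  rewrite U1 U2 /m !mu_slabU //; congr (_ + _)%E.
  rewrite -/(m _) -/(m _) -(mD u [set 0]) //; congr (m _).
  by rewrite image_set1 addr0.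
rewrite scaleE //; have [t_lt0|t_gt0|t_eq0] := ltrgt0P t; last by rewrite t_eq0 eqxx in t0.
  by rewrite posE // pos_scale.
rewrite negE // -pos_scale ?oppr_gt0 // face ?oppr_gt0 //.
by rewrite -(mD (- t) `]t, 0]) // shift_itv addrC subrr addr0.
Qed.

(* The part of the sheared parallelepiped beyond the unit interval in the
   direction of [v j], moved back by [v j], fills exactly what it left free. *)
Lemma vol_shear (v : 'I_n -> V) (i j : 'I_n) : i != j -> basis_of fullv (codom v) ->
  vol mu (fun k => if k == i then v i + v j else v k) = vol mu v.
Proof.
move=> ij bv; have [w [wv vE]] := dual_family bv.
(* The dual family of the sheared basis: [a v_i + b v_j = a (v_i + v_j) + (b - a) v_j]. *)
pose w' k := if k == j then w j - w i else w k.
have w'j x : dot (w' j) x = dot (w j) x - dot (w i) x by rewrite /w' eqxx dotBl.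
have w'N k x : k != j -> dot (w' k) x = dot (w k) x by rewrite /w' => /negbTE->.
rewrite /vol (parallelepiped_dual wv vE) (parallelepiped_dual (w := w')); last 2 first.
- move=> k l; have [->|kj] := eqVneq k j; rewrite ?w'j ?w'N //; case: (eqVneq l i) => [->|li].
  + by rewrite !dotDr !wv !eqxx (negbTE ij) (eq_sym j) (negbTE ij) /=; ring.
  + by rewrite !wv (eq_sym i) (negbTE li) subr0.
  + by rewrite dotDr !wv (negbTE kj) addr0.
  + exact: wv.
- move=> x; rewrite {1}(vE x) (bigD1 i) //= (bigD1 j) 1?eq_sym //=.
  rewrite [RHS](bigD1 i) //= [in RHS](bigD1 j) 1?eq_sym //= eqxx (negbTE ij).
  rewrite w'j w'N // scalerDr scalerBl !addrA; congr (_ + _).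
    by rewrite -!addrA; congr (_ + _); rewrite addrCA subrr addr0.
  by apply: eq_bigr => k /andP[ki kj]; rewrite w'N // (negbTE ki).
pose box (u : 'I_n -> V) := [set x : V | forall k, 0 <= dot (u k) x < 1] : set (borel dot).
have mbox u : measurable (box u).
  have -> : box u = \bigcap_(k in setT) (dot (u k) : borel dot -> R) @^-1` `[0, 1[.
    by apply/seteqP; split => x h k; have := h k; rewrite /= in_itv /= => // h'; apply: h'.
  apply: fin_bigcap_measurable => [|k _]; first exact: finite_finset.
  by rewrite -[X in measurable X]setTI; apply: measurable_dot.
have mhalf u a : measurable ([set x : V | dot u x < a] : set (borel dot)).
  have -> : ([set x : V | dot u x < a] : set (borel dot)) = (dot u : borel dot -> R) @^-1` `]-oo, a[.
    by apply/seteqP; split => x; rewrite /= in_itv.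
  by rewrite -[X in measurable X]setTI; apply: measurable_dot.
rewrite -/(box w) -/(box w').
pose H : set (borel dot) := [set x : V | dot (w j) x < 1].
(* [A] is the common part of the two parallelepipeds and [B] the rest of the original one; [BE]
   identifies [v j + B] with the rest of the sheared one. *)
pose A := box w' `&` H; pose B := box w `&` [set x : V | dot (w' j) x < 0].
have mA : measurable A by apply: measurableI; [exact: mbox|exact: mhalf].
have mB : measurable B by apply: measurableI; [exact: mbox|exact: mhalf].
have -> : box w = A `|` B.
  apply/seteqP; split => x.
    move=> xw; case: (ltP (dot (w' j) x) 0) => hj; [by right|left].
    split; last by case/andP: (xw j).
    move=> k; have [->|kj] := eqVneq k j; last by rewrite w'N.
    by rewrite hj w'j; case/andP: (xw j) (xw i) => _ h1 /andP[h2 _]; rewrite ltrBlDr (lt_le_trans h1) // lerDl.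
  case=> [[xw' /= xj] k|[]//]; have [->|kj] := eqVneq k j; last by rewrite -w'N.
  rewrite xj andbT; have := xw' j; have := xw' i; rewrite w'j w'N //.
  by move=> /andP[h1 _] /andP[h2 _]; lra.
have BE : [set (v j + x : V) | x in B] = box w' `\` H.
  apply/seteqP; split => [_ [y [yw /= yj] <-]|x [xw' /negP]].
    move: (yw j) (yw i) yj => /andP[y1 y2] /andP[y3 y4]; rewrite w'j => yj; split.
      move=> k; have [->|kj] := eqVneq k j; last by rewrite w'N // dotDr wv (negbTE kj) add0r.
      by rewrite w'j !dotDr !wv eqxx (negbTE ij) /=; apply/andP; split; lra.
    by apply/negP; rewrite -leNgt dotDr wv eqxx lerDl.
  rewrite -leNgt => hj; exists (x - v j); last by rewrite addrC subrK.
  have := xw' j; rewrite w'j; have := xw' i; rewrite w'N // => /andP[h1 h2] /andP[h3 h4].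
  split=> [k|]; rewrite /= ?w'j !dotBr !wv ?eqxx ?(negbTE ij); last by rewrite /=; lra.
  have [->|kj] := eqVneq k j; last by rewrite subr0 -w'N.
  by apply/andP; split; rewrite /=; lra.
have mH : measurable (box w' `\` H) by apply: measurableD; [exact: mbox|exact: mhalf].
have AB : A `&` B = set0.
  by apply/seteqP; split => // x [[xw' _] [_ /=]]; case/andP: (xw' j) => h _; rewrite ltNge h.
have AH : A `&` (box w' `\` H) = set0.
  by apply/seteqP; split => // x [[_ xH] [_]].
by rewrite -[in LHS](setUIDK (box w') H) -/A !measureU // -BE; congr (fine (_ + _)); exact: mu_translation.
Qed.

(** * The geometric determinant as sign times volume *)

Lemma geom_detE (v : 'I_n -> V) :
  geom_det mu e v = Num.sg (\det (gram_mx dot e v)) * vol mu v.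
Proof.
rewrite /geom_det; case: ifPn => [bv|]; first by rewrite (orientationE e_onb bv).
by rewrite (basis_of_det v e_onb) negbK => /eqP ->; rewrite sgr0 mul0r.
Qed.

(** Linearity in one row; scaling is the case [b = 0] and the shear is the case [a = b = 1], whose
    second term has equal rows [i] and [j]. *)
Lemma det_gram_mx_update (v : 'I_n -> V) (x : V) (i : 'I_n) (a b : R) (y z : V) :
  x = a *: y + b *: z ->
  \det (gram_mx dot e (fun k => if k == i then x else v k)) =
  a * \det (gram_mx dot e (fun k => if k == i then y else v k)) +
  b * \det (gram_mx dot e (fun k => if k == i then z else v k)).
Proof.
move=> ->; apply: (determinant_multilinear (i0 := i)).
- by apply/rowP => j; rewrite !mxE eqxx dotDl !dotZl.
- by apply/matrixP => k j; rewrite !mxE eq_sym (negbTE (neq_lift _ _)).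
- by apply/matrixP => k j; rewrite !mxE eq_sym (negbTE (neq_lift _ _)).
Qed.

Lemma det_gram_mx_scale (v : 'I_n -> V) (t : R) (i : 'I_n) :
  \det (gram_mx dot e (fun k => if k == i then t *: v i else v k)) =
  t * \det (gram_mx dot e v).
Proof.
rewrite (@det_gram_mx_update v _ i t 0 (v i) 0) ?scaler0 ?addr0 // mul0r addr0.
by congr (_ * \det (gram_mx _ _ _)); apply/funext => k; case: eqP => [->|].
Qed.

Lemma det_gram_mx_shear (v : 'I_n -> V) (i j : 'I_n) : i != j ->
  \det (gram_mx dot e (fun k => if k == i then v i + v j else v k)) =
  \det (gram_mx dot e v).
Proof.
move=> ij; rewrite (@det_gram_mx_update v _ i 1 1 (v i) (v j)) ?scale1r // !mul1r.
rewrite [X in _ + X](determinant_alternate ij) ?addr0.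
  by congr (\det (gram_mx _ _ _)); apply/funext => k; case: eqP => [->|].
by move=> k; rewrite !mxE eqxx eq_sym (negbTE ij).
Qed.

End Volume.

Theorem proposition3p1 (R : realType) (V : vectType R)
    (dot : {dot V for @idfun R}) (n : nat) (n_gt0 : (0 < n)%N)
    (e : 'I_n -> V) (e_onb : onb_of dot fullv e)
    (mu : {measure set (borel dot) -> \bar R})
    (mu_inv : normalized_invariant_measure e mu) :
  (forall (v : 'I_n -> V) (t : R) (i : 'I_n),
     geom_det mu e (fun k => if k == i then t *: v i else v k)
     = t * geom_det mu e v) /\
  (forall (v : 'I_n -> V) (i j : 'I_n), i != j ->
     geom_det mu e (fun k => if k == i then v i + v j else v k)
     = geom_det mu e v).
Proof.
case: mu_inv => mu_translation _; split=> [v t i|v i j ij].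
  rewrite !geom_detE // det_gram_mx_scale sgrM.
  (* The volume is compared only for [t] nonzero and [v] a basis; in the other two cases the sign
     factors vanish. The last line recombines the sign of [t] with [|t|]. *)
  have [->|t0] := eqVneq t 0; first by rewrite sgr0 !mul0r.
  have [->|d0] := eqVneq (\det (gram_mx dot e v)) 0; first by rewrite sgr0 mulr0 !mul0r mulr0.
  rewrite (vol_scale e_onb mu_translation) ?(basis_of_det v e_onb) //.
  by rewrite [in RHS](numEsg t); ring.
rewrite !geom_detE // det_gram_mx_shear //.
have [->|d0] := eqVneq (\det (gram_mx dot e v)) 0; first by rewrite sgr0 !mul0r.
by rewrite (vol_shear e_onb mu_translation ij) ?(basis_of_det v e_onb).
Qed.
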